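(* Let $a, b \in [0,1)^d$ and put $A:= [0,a)$, $B:= [0,b)$, and $D:=B \setminus A$. Let $(Z_n)_{n=1}^N$ be a set of (not necessarily independent) random points in $[0,1)^d$ that satisfies the following two conditions: (i) Different components of the random point set are mutually independent, i.e., writing $Z_{n,i}$ for the $i$th coordinate of $Z_n$, the $d$ random vectors $(Z_{n,i})_{n=1}^N$, $i\in[d]$, are mutually independent. (ii) For all $i\in [d]$ and for $I^{(0)}_{1,i} := [a_i,b_i)$, $I^{(0)}_{2,i} := [0,b_i)$ and $I^{(1)}_{1,i} := [b_i,1)$, $I^{(1)}_{2,i} := [0,a_i) \cup [b_i,1)$ there exists a $\delta_i >0$ such that for all $\sigma\in \{0,1\}$, $k\in \{0,1, \ldots, N\}$, $\nu \in \{ 0,1, \ldots, k\}$, and all $J\subseteq [N]$, $J_\nu, J_{k-\nu}\subseteq J$ with $|J|=k$, $|J_\nu|= \nu$, $|J_{k-\nu}| = k-\nu$ and $J_\nu \cap J_{k-\nu} = \emptyset$, one has $$\mathbb{P} \left( \bigwedge_{\ell \in J_\nu} Z_{\ell,i} \in I^{(\sigma)}_{1,i} \wedge \bigwedge_{\ell\in J_{k-\nu}} Z_{\ell,i} \in I^{(\sigma)}_{2,i} \right) \le \delta_i\, \lambda( I^{(\sigma)}_{1,i})^{\nu}\, \lambda( I^{(\sigma)}_{2,i})^{k-\nu}.$$ Then the random variables $$\mathbf{1}_D(Z_1), \ldots, \mathbf{1}_D(Z_N)$$ are $\gamma_d$-negatively dependent, where $\gamma_d := \prod_{i=1}^d 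\delta_i$.
   Context: Notation: $d,N\in\mathbb{N}$; $[N]=\{1,\dots,N\}$ and $[d]=\{1,\dots,d\}$; $\lambda$ is Lebesgue measure on $\mathbb{R}$; for $x,y\in\mathbb{R}^d$, $[x,y):=\prod_{j=1}^d[x_j,y_j)=\{z\in\mathbb{R}^d : x_j\le z_j<y_j \text{ for } j=1,\dots,d\}$ (so an interval $[s,t)$ with $s\ge t$ is empty); $\mathbf{1}_S$ is the indicator function of $S$; empty conjunctions are true and $0^0=1$. $\gamma$-negative dependence: let $\gamma\ge1$. Random variables $T_1,\dots,T_N$ with values in $\{0,1\}$ are called $\gamma$-negatively dependent if for all $u\subseteq[N]$ both $\mathbb{P}\big(\bigwedge_{j\in u}T_j=1\big)\le\gamma\prod_{j\in u}\mathbb{P}(T_j=1)$ and $\mathbb{P}\big(\bigwedge_{j\in u}T_j=0\big)\le\gamma\prod_{j\in u}\mathbb{P}(T_j=0)$.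
   Formalization: The formal theorem additionally assumes that each Z_n is uniformly distributed on [0,1)^d; without this the claim fails, e.g. d=1, N=2, a=0, b=1/2, Z_1=Z_2 lying in [0,1/2) with probability 1/10, delta_1=4. *)

(* Defs.v *)
From HB Require Import structures.
From mathcomp Require Import all_boot all_order all_algebra.
From mathcomp Require Import all_classical all_reals all_analysis.
Set Implicit Arguments.
Unset Strict Implicit.
Unset Printing Implicit Defensive.
Import Order.TTheory GRing.Theory Num.Theory.
Local Open Scope classical_set_scope.
Local Open Scope ring_scope.

(* Points of R^d are d-tuples; the measurable structure of d.-tuple R is the
   product sigma-algebra, i.e. the Borel sigma-algebra of R^d. *)

Definition box (R : realType) (d : nat) (x y : d.-tuple R) : set (d.-tuple R) :=
  [set z | forall j : 'I_d, tnth x j <= tnth z j < tnth y j].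

Definition origin (R : realType) (d : nat) : d.-tuple R :=
  [tuple (0 : R) | _ < d].

Definition unit_cube (R : realType) (d : nat) : set (d.-tuple R) :=
  [set z | forall j : 'I_d, 0 <= tnth z j < 1].

Section probability.
Context (disp : measure_display) (T : measurableType disp) (R : realType).
Variable P : probability T R.

Definition mutually_independent (dE : measure_display) (E : measurableType dE)
    (I : finType) (X : I -> {RV P >-> E}) : Prop :=
  forall (u : {set I}) (S : I -> set E),
    (forall i, i \in u -> measurable (S i)) ->
    P [set w | forall i, i \in u -> S i (X i w)] =
    (\prod_(i in u) P [set w | S i (X i w)])%E.

(* The law of [X] agrees with Lebesgue measure on [0,1)^d on all measurable
   rectangles, hence on all Borel sets. *)
Definition uniform_on_unit_cube (d : nat) (X : {RV P >-> d.-tuple R}) : Prop :=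
  forall S : 'I_d -> set R, (forall i, measurable (S i)) ->
    P [set w | forall i, S i (tnth (X w) i)] =
    (\prod_(i < d) lebesgue_measure (S i `&` `[0%R, 1%R[))%E.

Definition neg_dependent (gamma : R) (N : nat) (Y : 'I_N -> T -> R) : Prop :=
  [/\ 1 <= gamma,
      forall j, measurable_fun setT (Y j),
      forall j w, Y j w = 0 \/ Y j w = 1,
      forall u : {set 'I_N},
        (P [set w | forall j, j \in u -> Y j w = 1%R] <=
         gamma%:E * \prod_(j in u) P [set w | Y j w = 1%R])%E
    & forall u : {set 'I_N},
        (P [set w | forall j, j \in u -> Y j w = 0%R] <=
         gamma%:E * \prod_(j in u) P [set w | Y j w = 0%R])%E].

Section coordinate_vector.
Context (d N : nat) (Z : 'I_N -> {RV P >-> d.-tuple R}) (i : 'I_d).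

Definition coord_vec_fun (w : T) : N.-tuple R := [tuple tnth (Z n w) i | n < N].

Lemma measurable_coord_vec_fun : measurable_fun setT coord_vec_fun.
Proof.
apply/measurable_fun_tnthP => n.
rewrite (_ : _ \o _ = (@tnth _ _ ^~ i) \o Z n); last first.
  by apply/funext => w /=; rewrite tnth_mktuple.
by apply: measurableT_comp; [exact: measurable_tnth|exact: measurable_funPT].
Qed.

HB.instance Definition _ := isMeasurableFun.Build _ _ _ _
  coord_vec_fun measurable_coord_vec_fun.

(* The random vector (Z_{n,i})_{n=1}^N of all i-th coordinates. *)
Definition coord_vec : {RV P >-> N.-tuple R} := coord_vec_fun.

End coordinate_vector.
End probability.

(* The intervals I^(sigma)_{1,i} and I^(sigma)_{2,i}; [true] stands for
   sigma = 1. *)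
Definition I1 (R : realType) (d : nat) (a b : d.-tuple R)
    (sigma : bool) (i : 'I_d) : set R :=
  if sigma then [set` `[tnth b i, 1[] else [set` `[tnth a i, tnth b i[].

Definition I2 (R : realType) (d : nat) (a b : d.-tuple R)
    (sigma : bool) (i : 'I_d) : set R :=
  if sigma then [set` `[0, tnth a i[] `|` [set` `[tnth b i, 1[]
  else [set` `[0, tnth b i[].

(* Main.v *)
Require Import Defs.
From mathcomp Require Import all_boot all_order all_algebra.
From mathcomp Require Import all_classical all_reals all_analysis.
From mathcomp Require Import ring lra.
Import Order.TTheory GRing.Theory Num.Theory.
Local Open Scope classical_set_scope.
Local Open Scope ring_scope.

(** Write x_i and y_i for the indicators of [I1] and [I2] at the i-th
    coordinate of a point. For sigma = 0 the indicator of D is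
      prod_i y_i - prod_i (y_i - x_i),
    and for sigma = 1 the indicator of the complement of D is
      1 - prod_i (1 - x_i) + prod_i (y_i - x_i).
    These polynomials have negative coefficients, so the moment bounds (ii)
    cannot be inserted into their full expansion. The point is that as a
    function of one coordinate alone, all others being frozen at values with
    0 <= x_j <= y_j <= 1, each of them is c0 + c1 x_i + c2 y_i with
    c0, c1, c2 >= 0 ([diff_poly_affine], [codiff_poly_affine]).

    The probability that all Z_l with l in u lie in D (or all in its
    complement) is the expectation of the product over l of this polynomial.
    By (i) the coordinates can be integrated out one after the other. When the
    i-th one is integrated, expanding the product over l gives nonnegative
    multiples of the moments that (ii) controls ([average_prod_le]); resumming,
    the random pairs (x_i, y_i) of all N points have been replaced by the
    lengths of the two intervals, at the cost of one factor delta_i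
    ([hybrid_mean_step]). The bounds 0 <= x <= y <= 1 persist for these lengths,
    so the procedure can go on with the next coordinate. After d steps the
    expectation has become the product over l of the polynomial at the interval
    lengths, and by uniformity this is the product of the marginal probabilities
    ([probability_indic_diff]).

    For each i only the finitely many patterns of memberships of the Z_{l,i} in
    the two intervals matter, so all expectations are finite sums over these
    configurations, and the integration is finite combinatorics. *)

(** * Replacing random coordinates by their means *)

Section averaging.
Set Implicit Arguments.
Unset Strict Implicit.

Lemma big_option_bool (V : nmodType) (F : option bool -> V) :
  \sum_k F k = F None + F (Some true) + F (Some false).
Proof.
rewrite (bigD1 None) //= (bigD1 (Some true)) //= (bigD1 (Some false)) //=.
by rewrite big1 ?addr0 ?addrA // => -[[]|].
Qed.

Lemma prod_natr_forall (R : comNzSemiRingType) (I : finType) (A p : pred I) :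
  \prod_(i | A i) (p i)%:R = [forall (i | A i), p i]%:R :> R.
Proof.
have [/forall_inP h|/forall_inPn[i Ai pi]] := boolP [forall (i | A i), p i].
  by rewrite big1 // => i Ai; rewrite h.
by rewrite (bigD1 i) //= (negbTE pi) mul0r.
Qed.

(** The terms of a function that is affine in the pair (x, y) of one
    coordinate. *)
Definition monomial (R : pzRingType) (k : option bool) (p : R * R) : R :=
  if k is Some s then (if s then p.1 else p.2) else 1.

(** Multiplying out the product over l gives one term for each choice of a
    monomial per point. Its coefficient is nonnegative, and the points choosing
    x and those choosing y form disjoint sets U and V, so the assumed moment
    bound applies term by term. Points choosing the constant are in neither set,
    which is why moments over all pairs of disjoint sets are required. *)
Lemma average_prod_le (R : numDomainType) (L C : finType) (mu : C -> R)
    (z : C -> L -> R * R) (m : R * R) (delta : R) (c : L -> option bool -> R) :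
  (forall U V : {set L}, U :&: V = finset.set0 ->
    \sum_e mu e * ((\prod_(l in U) (z e l).1) * \prod_(l in V) (z e l).2)
      <= delta * (m.1 ^+ #|U| * m.2 ^+ #|V|)) ->
  (forall l k, 0 <= c l k) ->
  \sum_e mu e * (\prod_l \sum_k c l k * monomial k (z e l))
    <= delta * \prod_l \sum_k c l k * monomial k m.
Proof.
move=> hmom c0.
have expand (q : L -> R * R) : \prod_l \sum_k c l k * monomial k (q l) =
    \sum_(f : {ffun L -> option bool}) (\prod_l c l (f l)) *
      ((\prod_(l in finset (fun l => f l == Some true)) (q l).1) *
        \prod_(l in finset (fun l => f l == Some false)) (q l).2).
  rewrite bigA_distr_bigA; apply: eq_bigr => f _; rewrite big_split /=.
  congr (_ * _); rewrite [in X in _ * X]big_mkcond [X in X * _]big_mkcond -big_split /=.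
  apply: eq_bigr => l _; rewrite !inE /monomial.
  by case: (f l) => [[]|] /=; rewrite ?mulr1 ?mul1r.
rewrite (expand (fun=> m)) mulr_sumr.
under eq_bigr do rewrite (expand (z _)) mulr_sumr.
rewrite exchange_big /=; apply: ler_sum => f _.
under eq_bigr do rewrite mulrCA.
rewrite -mulr_sumr mulrCA; apply: ler_wpM2l; first exact: prodr_ge0.
rewrite !prodr_const; apply: hmom.
by apply/setP => l; rewrite !inE; case: (f l) => [[]|].
Qed.

Definition update (I : eqType) (A : Type) (v : I -> A) (i : I) (p : A) : I -> A :=
  fun j => if j == i then p else v j.

Definition admissible (R : numDomainType) (I : Type) (v : I -> R * R) : Prop :=
  forall i, 0 <= (v i).1 /\ (v i).1 <= (v i).2 <= 1.

(** Affine with nonnegative coefficients in each coordinate separately. The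
    coefficients may depend on the frozen values of the other coordinates, and
    nonnegativity is only asked when those are admissible; this is weaker than
    having a nonnegative expansion in all coordinates jointly. *)
Definition nonneg_affine (R : numDomainType) (I : eqType)
    (G : (I -> R * R) -> R) : Prop :=
  forall i v, admissible v -> exists2 c : option bool -> R,
    forall k, 0 <= c k & forall p, G (update v i p) = \sum_k c k * monomial k p.

(** Isolates the i-th coordinate of a family as an independent summation
    variable. The remaining coordinates are represented by the families whose
    i-th entry has the fixed value e0. *)
Lemma sum_ffun_split (V : nmodType) (I C : finType) (F : {ffun I -> C} -> V) i e0 :
  \sum_k F k = \sum_(k : {ffun I -> C} | k i == e0) \sum_e F [ffun j => update k i e j].
Proof.
rewrite pair_big_dep /=.
rewrite (reindex_onto (fun k : {ffun I -> C} => ([ffun j => update k i e0 j], k i))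
  (fun q : {ffun I -> C} * C => [ffun j => update q.1 i q.2 j])) /=.
  apply: eq_big => [k|k _].
    rewrite ffunE /update eqxx eqxx /=; symmetry; apply/eqP/ffunP => j.
    by rewrite !ffunE; case: eqP => [->|].
  by congr F; apply/ffunP => j; rewrite !ffunE /update ffunE; case: eqP => [->|].
move=> [k e] /= /andP[/eqP ki _]; congr pair.
  apply/ffunP => j; rewrite !ffunE /update; case: eqP => [->|//]; first by rewrite ki.
  by rewrite ffunE /update; case: eqP.
by rewrite ffunE /update eqxx.
Qed.

Section hybrid.
Variables (R : numDomainType) (I L C : finType) (mu : I -> C -> R).
Variables (z : I -> C -> L -> R * R) (m : I -> R * R) (delta : I -> R).
Variable G : L -> (I -> R * R) -> R.

(** Interpolates between the expectation of the product of the [G l], for empty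
    s, and the product of the [G l] at the means, when s lists all of I. *)
Definition hybrid_mean (s : seq I) : R :=
  \sum_(k : {ffun I -> C}) (\prod_i mu i (k i)) *
    \prod_l G l (fun i => if i \in s then m i else z i (k i) l).

Hypothesis mu_ge0 : forall i e, 0 <= mu i e.
Hypothesis mu_sum1 : forall i, \sum_e mu i e = 1.
Hypothesis z_adm : forall e l, admissible (fun i => z i (e i) l).
Hypothesis m_adm : admissible m.
Hypothesis moments : forall i (U V : {set L}), U :&: V = finset.set0 ->
  \sum_e mu i e * ((\prod_(l in U) (z i e l).1) * \prod_(l in V) (z i e l).2)
    <= delta i * ((m i).1 ^+ #|U| * (m i).2 ^+ #|V|).
Hypothesis G_affine : forall l, nonneg_affine (G l).

(** Freeze all coordinates but i. Every [G l] is then affine in the i-th pair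
    with nonnegative coefficients that do not depend on the i-th configuration,
    so [average_prod_le] replaces that pair by its mean for every l at once. *)
Lemma hybrid_mean_step s i : i \notin s ->
  hybrid_mean s <= delta i * hybrid_mean (i :: s).
Proof.
move=> iNs.
have [e0|noC] := pickP (@predT C); last first.
  have := mu_sum1 i; rewrite big_pred0 => [/eqP|e]; last exact: (noC e).
  by rewrite eq_sym oner_eq0.
move=> _; rewrite /hybrid_mean.
rewrite (sum_ffun_split _ i e0) [in leRHS](sum_ffun_split _ i e0) mulr_sumr.
apply: ler_sum => k _.
pose v l := fun j => if j \in s then m j else z j (k j) l.
pose w := \prod_(j | j != i) mu j (k j).
have split_mu e : \prod_j mu j ([ffun j => update k i e j] j) = w * mu i e.
  rewrite (bigD1 i) //= ffunE /update eqxx mulrC; congr (_ * _).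
  by apply: eq_bigr => j ji; rewrite ffunE (negbTE ji).
have w0 : 0 <= w by apply: prodr_ge0.
have lhsE e : (fun l j => if j \in s then m j
      else z j ([ffun j => update k i e j] j) l) = fun l => update (v l) i (z i e l).
  apply/funext => l; apply/funext => j; rewrite ffunE /update /v.
  by case: (eqVneq j i) => [->|//]; rewrite (negbTE iNs).
have rhsE e : (fun l j => if j \in i :: s then m j
      else z j ([ffun j => update k i e j] j) l) = fun l => update (v l) i (m i).
  apply/funext => l; apply/funext => j; rewrite ffunE /update /v inE.
  by case: (eqVneq j i) => [->|].
have v_adm l : admissible (v l).
  by move=> j; rewrite /v; case: ifP => _; [exact: m_adm|exact: (z_adm k l j)].
have /choice[c hc] l : exists c : option bool -> R, (forall q, 0 <= c q) /\
    forall p, G l (update (v l) i p) = \sum_q c q * monomial q p.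
  by have [c c0 cE] := G_affine l i (v_adm l); exists c.
under eq_bigr => e _.
  rewrite split_mu -mulrA.
  under eq_bigr do rewrite (congr1 (fun h => G _ (h _)) (lhsE e)) (hc _).2.
  over.
under [in leRHS]eq_bigr => e _.
  rewrite split_mu -mulrA.
  under eq_bigr do rewrite (congr1 (fun h => G _ (h _)) (rhsE e)) (hc _).2.
  over.
rewrite -!mulr_sumr -mulr_suml mu_sum1 mul1r mulrCA.
apply: ler_wpM2l => //; apply: average_prod_le; first exact: moments.
by move=> l q; exact: (hc l).1.
Qed.

Lemma mean_prod_le : (forall i, 0 <= delta i) ->
  hybrid_mean [::] <= (\prod_i delta i) * \prod_l G l m.
Proof.
move=> delta0.
have step s : uniq s -> hybrid_mean [::] <= (\prod_(i <- s) delta i) * hybrid_mean s.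
  elim: s => [_|i s IHs /= /andP[iNs us]]; first by rewrite big_nil mul1r.
  apply: le_trans (IHs us) _; rewrite big_cons mulrAC [leRHS]mulrC.
  apply: ler_wpM2l; first exact: prodr_ge0.
  exact: hybrid_mean_step.
apply: le_trans (step _ (index_enum_uniq I)) _.
suff -> : hybrid_mean (index_enum I) = \prod_l G l m by [].
rewrite /hybrid_mean; transitivity (\sum_(k : {ffun I -> C})
    (\prod_i mu i (k i)) * \prod_l G l m).
  apply: eq_bigr => k _; congr (_ * _); apply: eq_bigr => l _; congr (G l _).
  by apply/funext => i; rewrite mem_index_enum.
rewrite -mulr_suml -(bigA_distr_bigA mu) /= big1 ?mul1r //.
Qed.
End hybrid.

(** At x_i = 1_[a_i,b_i), y_i = 1_[0,b_i), so that y_i - x_i is the indicator of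
    [0, min(a_i,b_i)), this is the indicator of B minus that of A n B. *)
Definition diff_poly (R : numDomainType) (I : finType) (v : I -> R * R) : R :=
  \prod_i (v i).2 - \prod_i ((v i).2 - (v i).1).

(** At x_i = 1_[b_i,1), y_i = 1 - 1_[a_i,b_i), this is the indicator of the
    complement of B plus that of A n B. *)
Definition codiff_poly (R : numDomainType) (I : finType) (v : I -> R * R) : R :=
  1 - \prod_i (1 - (v i).1) + \prod_i ((v i).2 - (v i).1).

Lemma prod_update (R : comPzRingType) (I : finType) (A : Type) (h : A -> R)
    (v : I -> A) i p :
  \prod_j h (update v i p j) = h p * \prod_(j | j != i) h (v j).
Proof.
rewrite (bigD1 i) //= /update eqxx; congr (_ * _).
by apply: eq_bigr => j ji; rewrite (negbTE ji).
Qed.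

Definition coefs (R : pzRingType) (c0 c1 c2 : R) (k : option bool) : R :=
  if k is Some s then (if s then c1 else c2) else c0.

(** With p and q the products of the y_j and of the y_j - x_j over j <> i, the
    value is p y - q (y - x) = q x + (p - q) y, and q <= p. *)
Lemma diff_poly_affine (R : numDomainType) (I : finType) :
  nonneg_affine (@diff_poly R I).
Proof.
move=> i v vadm.
pose p := \prod_(j | j != i) (v j).2.
pose q := \prod_(j | j != i) ((v j).2 - (v j).1).
exists (coefs 0 q (p - q)) => [[[]|] //=|x].
- by apply: prodr_ge0 => j _; rewrite subr_ge0; have [_ /andP[]] := vadm j.
- rewrite subr_ge0; apply: ler_prod => j _; have [v0 /andP[v12 v1]] := vadm j.
  by rewrite subr_ge0 v12 lerBlDr lerDl.
rewrite big_option_bool /= /diff_poly (prod_update snd).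
rewrite (prod_update (fun x => x.2 - x.1)) -/p -/q.
by ring.
Qed.

(** With p and q the products of the 1 - x_j and of the y_j - x_j over j <> i,
    the value is 1 - p (1 - x) + q (y - x) = (1 - p) + (p - q) x + q y, and
    q <= p <= 1. *)
Lemma codiff_poly_affine (R : numDomainType) (I : finType) :
  nonneg_affine (@codiff_poly R I).
Proof.
move=> i v vadm.
pose p := \prod_(j | j != i) (1 - (v j).1).
pose q := \prod_(j | j != i) ((v j).2 - (v j).1).
exists (coefs (1 - p) (p - q) q) => [[[]|] /=|x].
- rewrite subr_ge0; apply: ler_prod => j _; have [v0 /andP[v12 v1]] := vadm j.
  by rewrite subr_ge0 v12 lerD2r.
- by apply: prodr_ge0 => j _; rewrite subr_ge0; have [_ /andP[]] := vadm j.
- rewrite subr_ge0; apply: prodr_ile1 => j _; have [v0 /andP[v12 v1]] := vadm j.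
  by rewrite subr_ge0 (le_trans v12 v1) lerBlDr lerDl.
rewrite big_option_bool /= /codiff_poly (prod_update (fun x => 1 - x.1)).
rewrite (prod_update (fun x => x.2 - x.1)) -/p -/q.
by ring.
Qed.
End averaging.

(** * Events determined by a finite-valued random variable *)

Section events.
Set Implicit Arguments.
Unset Strict Implicit.
Local Open Scope classical_set_scope.

Lemma measurable_forall_fin (disp : measure_display) (T : measurableType disp)
    (I : finType) (A : I -> set T) :
  (forall i, measurable (A i)) -> measurable [set t | forall i, A i t].
Proof.
move=> mA; rewrite (_ : [set t | _] = \bigcap_(i in [set: I]) A i); last first.
  by apply/seteqP; split => t /= tA i //; exact: tA.
by apply: fin_bigcap_measurable => // i _; exact: mA.
Qed.

Lemma measurable_rectangle (disp : measure_display) (E : measurableType disp)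
    (n : nat) (S : 'I_n -> set E) :
  (forall i, measurable (S i)) ->
  measurable [set t : n.-tuple E | forall i, S i (tnth t i)].
Proof.
move=> mS; apply: measurable_forall_fin => i.
by rewrite -[X in measurable X]setTI; apply: measurable_tnth.
Qed.

Lemma probability_pred_comp (R : realType) (disp : measure_display)
    (T : measurableType disp) (P : probability T R) (F : finType) (K : T -> F)
    (Q : pred F) :
  (forall k, measurable [set w | K w = k]) ->
  P [set w | Q (K w)] = (\sum_k fine (P [set w | K w = k]) * (Q k)%:R)%:E.
Proof.
move=> mK.
have sumP s : uniq s -> P [set w | K w \in s] = (\sum_(k <- s) P [set w | K w = k])%E
    /\ measurable [set w | K w \in s].
  elim: s => [_|k s IHs /= /andP[ks us]].
    have -> : [set w | K w \in [::]] = set0 by apply/seteqP; split.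
    by rewrite big_nil measure0.
  have [IH1 IH2] := IHs us.
  have -> : [set w | K w \in k :: s] = [set w | K w = k] `|` [set w | K w \in s].
    apply/seteqP; split => w /=; rewrite inE.
      by move=> /orP[/eqP|]; [left|right].
    by case=> [->|->]; rewrite ?eqxx ?orbT.
  split; last exact: measurableU.
  rewrite big_cons -IH1 measureU //.
  by apply/seteqP; split => w //= -[->]; rewrite (negbTE ks).
rewrite (_ : [set w | _] = [set w | K w \in enum Q]); last first.
  by apply/seteqP; split => w /=; rewrite mem_enum.
rewrite (sumP _ (enum_uniq _)).1 big_enum -sumEFin big_mkcond /=.
apply: eq_bigr => k _; rewrite -topredE /=; case: (Q k); last by rewrite mulr0.
by rewrite mulr1 fineK // fin_num_measure.
Qed.

End events.

(** * The two intervals and the set D *)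

Section geometry.
Set Implicit Arguments.
Unset Strict Implicit.
Local Open Scope classical_set_scope.

Variables (R : realType) (d : nat) (a b : d.-tuple R).
Hypotheses (ha : unit_cube a) (hb : unit_cube b).

Definition interval_lengths (sigma : bool) (i : 'I_d) : R * R :=
  let q := Num.max 0 (tnth b i - tnth a i) in
  if sigma then (1 - tnth b i, 1 - q) else (q, tnth b i).

Lemma measurable_I1 sigma i : measurable (I1 a b sigma i).
Proof. by case: sigma; exact: measurable_itv. Qed.

Lemma measurable_I2 sigma i : measurable (I2 a b sigma i).
Proof.
by case: sigma; rewrite /I2; [apply: measurableU|]; exact: measurable_itv.
Qed.

Lemma sub_I1_I2 sigma i : I1 a b sigma i `<=` I2 a b sigma i.
Proof.
have /andP[a0 _] := ha i.
case: sigma => x /=; rewrite !in_itv /=; first by right.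
by move=> /andP[ax ->]; rewrite (le_trans a0 ax).
Qed.

Lemma lebesgue_measure_I1 sigma i :
  lebesgue_measure (I1 a b sigma i) = (interval_lengths sigma i).1%:E.
Proof.
have /andP[b0 b1] := hb i.
case: sigma; rewrite /= lebesgue_measure_itv /= lte_fin ?b1 //.
by case: ltP => ab; [rewrite max_r -?EFinB //; lra|rewrite max_l //; lra].
Qed.

Lemma lebesgue_measure_I2 sigma i :
  lebesgue_measure (I2 a b sigma i) = (interval_lengths sigma i).2%:E.
Proof.
have /andP[a0 a1] := ha i; have /andP[b0 b1] := hb i.
case: sigma; last first.
  rewrite /= lebesgue_measure_itv /= lte_fin.
  by case: ltP => b0'; rewrite ?oppr0 ?sube0 //; congr EFin; lra.
rewrite /=; have [ab|ba] := leP (tnth a i) (tnth b i).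
  rewrite measureU; [|exact: measurable_itv|exact: measurable_itv|]; last first.
    apply/seteqP; split => // x [] /=; rewrite !in_itv /= => /andP[_ xa] /andP[bx _].
    by have := le_lt_trans bx xa; rewrite ltNge ab.
  rewrite [X in (X + _)%E]lebesgue_measure_itv [X in (_ + X)%E]lebesgue_measure_itv /=.
  rewrite !lte_fin b1 max_r; last by lra.
  case: ltP => a0' /=; rewrite -?EFinB -?EFinD; congr EFin; lra.
rewrite max_l; last by lra.
rewrite (_ : _ `|` _ = `[0, 1[).
  by rewrite lebesgue_measure_itv /= lte_fin ltr01 -EFinB.
apply/seteqP; split => x /=; rewrite !in_itv /=.
  by case=> /andP[? ?]; apply/andP; split; lra.
move=> /andP[x0 x1]; have [xa|ax] := ltP x (tnth a i); [left|right].
  by rewrite x0.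
by rewrite x1 andbT; lra.
Qed.

Lemma interval_lengths_admissible sigma : admissible (interval_lengths sigma).
Proof.
move=> i; have /andP[a0 a1] := ha i; have /andP[b0 b1] := hb i.
by rewrite /interval_lengths; case: sigma => /=;
  case: (leP 0 (tnth b i - tnth a i)) => ?; split; try (apply/andP; split); lra.
Qed.

(** Membership in D (in its complement, for sigma = 1) read off from the truth
    values x_i, y_i of the memberships in [I1] and [I2]. *)
Definition in_diff (sigma : bool) (x y : 'I_d -> bool) : bool :=
  if sigma then [exists i, x i] || [forall i, y i]
  else [forall i, y i] && [exists i, x i].

Definition diff_value (sigma : bool) (v : 'I_d -> R * R) : R :=
  if sigma then codiff_poly v else diff_poly v.

Lemma diff_value_affine sigma : nonneg_affine (diff_value sigma).
Proof. by case: sigma; [exact: codiff_poly_affine|exact: diff_poly_affine]. Qed.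

Lemma diff_value_bool sigma (x y : 'I_d -> bool) : (forall i, x i -> y i) ->
  diff_value sigma (fun i => ((x i)%:R, (y i)%:R)) = (in_diff sigma x y)%:R.
Proof.
move=> xy.
have prod_all (p : 'I_d -> bool) : \prod_i (p i)%:R = [forall i, p i]%:R :> R.
  exact: (prod_natr_forall R xpredT).
have prod_y : \prod_i (y i)%:R = [forall i, y i]%:R :> R by exact: prod_all.
have prod_Nx : \prod_i (1 - (x i)%:R) = (~~ [exists i, x i])%:R :> R.
  rewrite negb_exists -prod_all; apply: eq_bigr => i _.
  by case: (x i); rewrite ?subrr ?subr0.
have prod_yNx : \prod_i ((y i)%:R - (x i)%:R) =
    ([forall i, y i] && ~~ [exists i, x i])%:R :> R.
  rewrite negb_exists (_ : _ && _ = [forall i, y i && ~~ x i]).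
    rewrite -prod_all; apply: eq_bigr => i _.
    by have := xy i; case: (x i) => [->//|_]; rewrite ?subrr // subr0 andbT.
  apply/andP/forallP => [[/forallP yi /forallP xi] i|h]; first by rewrite yi xi.
  by split; apply/forallP => i; have /andP[] := h i.
rewrite /diff_value /diff_poly /codiff_poly /in_diff /=.
case: sigma; rewrite ?prod_y ?prod_Nx prod_yNx.
  by case: [exists i, x i]; case: [forall i, y i]; rewrite /= ?subr0 ?addr0 ?subrr ?add0r.
by case: [exists i, x i]; case: [forall i, y i]; rewrite /= ?subr0 ?subrr.
Qed.

Lemma in_diffP sigma (t : d.-tuple R) : unit_cube t ->
  (in_diff sigma (fun i => tnth t i \in I1 a b sigma i)
                 (fun i => tnth t i \in I2 a b sigma i)) =
  ((t \in box (origin R d) b `\` box (origin R d) a) == ~~ sigma).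
Proof.
move=> ht.
have inB : (t \in box (origin R d) b) = [forall i, tnth t i < tnth b i].
  apply/idP/forallP => [|h]; first by rewrite inE => h i; have /andP[] := h i.
  by rewrite inE => i; rewrite h tnth_mktuple; have /andP[->] := ht i.
have inA : (t \in box (origin R d) a) = [forall i, tnth t i < tnth a i].
  apply/idP/forallP => [|h]; first by rewrite inE => h i; have /andP[] := h i.
  by rewrite inE => i; rewrite h tnth_mktuple; have /andP[->] := ht i.
have -> : (t \in box (origin R d) b `\` box (origin R d) a) =
    [forall i, tnth t i < tnth b i] && ~~ [forall i, tnth t i < tnth a i].
  by rewrite in_setD inB inA.
rewrite /in_diff; case: sigma => /=.
  rewrite eqbF_neg negb_and negbK negb_forall.
  have -> : [exists i, tnth t i \in I1 a b true i] = [exists i, ~~ (tnth t i < tnth b i)].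
    apply: eq_existsb => i; rewrite -leNgt; apply/idP/idP; rewrite inE /= in_itv /=.
      by move=> /andP[].
    by move=> ->; have /andP[] := ht i.
  have [//|/existsPn tb /=] := boolP [exists i, ~~ (tnth t i < tnth b i)].
  apply: eq_forallb => i; apply/idP/idP; rewrite inE /= !in_itv /=; have /andP[-> ->] := ht i.
    by rewrite andbT => -[//|/=]; rewrite leNgt (negbNE (tb i)).
  by left.
rewrite eqb_id negb_forall.
have -> : [forall i, tnth t i \in I2 a b false i] = [forall i, tnth t i < tnth b i].
  by apply: eq_forallb => i; apply/idP/idP; rewrite inE /= in_itv /=; have /andP[-> _] := ht i.
have [/forallP tb /=|//] := boolP [forall i, tnth t i < tnth b i].
apply: eq_existsb => i; rewrite -leNgt; apply/idP/idP; rewrite inE /= in_itv /=.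
  by move=> /andP[].
by move=> ->; rewrite tb.
Qed.
End geometry.

(** * Configurations of the random points *)

Section random_points.
Set Implicit Arguments.
Unset Strict Implicit.
Local Open Scope classical_set_scope.

Variables (R : realType) (disp : measure_display) (T : measurableType disp).
Variables (P : probability T R) (d N : nat) (a b : d.-tuple R).
Variables (Z : 'I_N -> {RV P >-> d.-tuple R}) (delta : 'I_d -> R).
Hypotheses (ha : unit_cube a) (hb : unit_cube b).
Hypothesis hZ : forall n w, unit_cube (Z n w).

Let D : set (d.-tuple R) := box (origin R d) b `\` box (origin R d) a.

Lemma measurable_box (x y : d.-tuple R) : measurable (box x y).
Proof.
apply: (@measurable_rectangle _ _ d (fun j => `[tnth x j, tnth y j[)) => j.
exact: measurable_itv.
Qed.

Lemma measurable_box_diff : measurable D.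
Proof. by apply: measurableD; exact: measurable_box. Qed.

Lemma indic_diffE sigma j w : (\1_D (Z j w) = (~~ sigma)%:R :> R) <->
  in_diff sigma (fun i => tnth (Z j w) i \in I1 a b sigma i)
                (fun i => tnth (Z j w) i \in I2 a b sigma i).
Proof.
rewrite in_diffP // -/D indicE.
split=> [|/eqP -> //]; case: (_ \in D); case: sigma => //= /eqP;
  by rewrite ?oner_eq0 // eq_sym oner_eq0.
Qed.

(** D = B minus A, where B and A n B are boxes cornered at the origin, with upper
    corners b and min(a, b). *)
Lemma probability_diff (X : {RV P >-> d.-tuple R}) :
  uniform_on_unit_cube X -> 
  P [set w | D (X w)] = (diff_poly (interval_lengths a b false))%:E.
Proof.
move=> hunif.
have mX (S : set (d.-tuple R)) : measurable S -> measurable [set w | S (X w)].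
  by move=> mS; rewrite -[X in measurable X]setTI; exact: (measurable_funPT X).
have corner (y : 'I_d -> R) : (forall i, 0 <= y i <= 1) ->
    P [set w | forall i, (`[0, y i[ : set R) (tnth (X w) i)] = (\prod_i y i)%:E.
  move=> hy; rewrite (hunif (fun i => `[0, y i[)); last by move=> i; exact: measurable_itv.
  rewrite -prodEFin; apply: eq_bigr => i _; have /andP[y0 y1] := hy i.
  rewrite (_ : _ `&` _ = `[0, y i[).
    rewrite lebesgue_measure_itv /= lte_fin.
    by case: ltP => y0'; rewrite ?oppr0 ?sube0 //; congr EFin; lra.
  apply/seteqP; split => x /=; rewrite !in_itv /=; first by case.
  by move=> /andP[-> xy]; rewrite xy (lt_le_trans xy y1).
have PB : P [set w | box (origin R d) b (X w)] = (\prod_i tnth b i)%:E.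
  rewrite -corner; last first.
    by move=> i; have /andP[b0 /ltW b1] := hb i; rewrite b0.
  congr (P _); apply/seteqP; split => w /= h i; have := h i;
    by rewrite tnth_mktuple ?in_itv.
have PAB : P ([set w | box (origin R d) b (X w)] `&` [set w | box (origin R d) a (X w)]) =
    (\prod_i Num.min (tnth a i) (tnth b i))%:E.
  rewrite -corner; last first.
    move=> i; have /andP[b0 /ltW b1] := hb i; have /andP[a0 /ltW a1] := ha i.
    by rewrite le_min a0 b0 ge_min a1.
  congr (P _); apply/seteqP; split => w /=.
    move=> [hB hA] i; have := hB i; have := hA i.
    by rewrite tnth_mktuple !in_itv /= lt_min => /andP[-> ->] /andP[_ ->].
  by move=> h; split => i; have := h i;
    rewrite tnth_mktuple !in_itv /= lt_min => /and3P[-> ? ?].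
rewrite (_ : [set w | _] = [set w | box (origin R d) b (X w)] `\`
    [set w | box (origin R d) a (X w)]) //.
have mbox y : measurable [set w | box (origin R d) y (X w)].
  by apply: mX; exact: measurable_box.
rewrite measureD //; last by rewrite -ge0_fin_numE // fin_num_measure.
rewrite [X in (X - _)%E]PB [X in (_ - X)%E]PAB -EFinB /diff_poly /=; congr (_ - _)%:E.
apply: eq_bigr => i _.
by case: (leP (tnth a i) (tnth b i)) => ?; [rewrite max_r|rewrite max_l]; lra.
Qed.

Lemma probability_indic_diff sigma j : uniform_on_unit_cube (Z j) ->
  P [set w | \1_D (Z j w) = (~~ sigma)%:R :> R] =
    (diff_value sigma (interval_lengths a b sigma))%:E.
Proof.
move=> hunif; have PD := probability_diff hunif.
case: sigma => /=; last first.
  rewrite -PD; congr (P _); apply/seteqP; split => w /=; rewrite indicE.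
    by case: (boolP (_ \in D)) => [/set_mem//|_ /eqP]; rewrite eq_sym oner_eq0.
  by move=> h; rewrite mem_set.
rewrite (_ : [set w | _] = ~` [set w | D (Z j w)]); last first.
  apply/seteqP; split => w /=; rewrite indicE.
    by move=> /eqP + h; rewrite mem_set // oner_eq0.
  by move=> h; rewrite memNset.
have mD : measurable [set w | D (Z j w)].
  rewrite -[X in measurable X]setTI; apply: (measurable_funPT (Z j)) => //.
  exact: measurable_box_diff.
rewrite probability_setC // [X in (_ - X)%E]PD -EFinB /diff_poly /codiff_poly /=.
congr EFin; rewrite opprD opprK addrA; congr (_ - _ + _).
  by apply: eq_bigr => i _; ring.
by apply: eq_bigr => i _; ring.
Qed.

Let config : finType := {ffun 'I_N -> bool * bool}.

Definition configuration (sigma : bool) (i : 'I_d) (t : N.-tuple R) : config :=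
  [ffun l => (tnth t l \in I1 a b sigma i, tnth t l \in I2 a b sigma i)].

Lemma measurable_configuration sigma i c :
  measurable [set t | configuration sigma i t = c].
Proof.
pose S (l : 'I_N) : set R :=
  (if (c l).1 then I1 a b sigma i else ~` I1 a b sigma i) `&`
  (if (c l).2 then I2 a b sigma i else ~` I2 a b sigma i).
rewrite (_ : [set t | _] = [set t | forall l, S l (tnth t l)]).
  apply: measurable_rectangle => l; apply: measurableI.
    by case: ifP => _; [|apply: measurableC]; exact: measurable_I1.
  by case: ifP => _; [|apply: measurableC]; exact: measurable_I2.
apply/seteqP; split => t /=.
  move=> tc l; rewrite /S -tc ffunE /=.
  by split; case: ifPn => [/set_mem//|/negP h xI]; apply: h; exact: mem_set.
move=> h; apply/ffunP => l; rewrite ffunE; have := h l; rewrite /S.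
case: (c l) => [c1 c2] /= [h1 h2]; congr pair.
  by case: c1 h1 => h1; [rewrite mem_set|rewrite memNset].
by case: c2 h2 => h2; [rewrite mem_set|rewrite memNset].
Qed.

Definition config_prob sigma i (c : config) : R :=
  fine (P [set w | configuration sigma i (coord_vec Z i w) = c]).

(** The conjunction forces x <= y also on the patterns that no point realises
    ([I1] is contained in [I2]), so that the values are admissible for every
    configuration. *)
Definition config_value (c : config) (l : 'I_N) : R * R :=
  (((c l).1 && (c l).2)%:R, (c l).2%:R).

Lemma measurable_config_event sigma i c :
  measurable [set w | configuration sigma i (coord_vec Z i w) = c].
Proof.
rewrite -[X in measurable X]setTI; have := measurable_funPT (coord_vec Z i).
by move=> /(_ measurableT _ (@measurable_configuration sigma i c)).
Qed.

Lemma config_prob_ge0 sigma i c : 0 <= config_prob sigma i c.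
Proof. exact: fine_ge0. Qed.

Lemma config_prob_sum1 sigma i : \sum_c config_prob sigma i c = 1.
Proof.
apply: EFin_inj.
have := probability_pred_comp P xpredT (measurable_config_event sigma i).
rewrite (_ : [set w | _] = setT) ?probability_setT; last by apply/seteqP; split.
by move=> ->; congr EFin; apply: eq_bigr => c _; rewrite mulr1.
Qed.

Lemma moment_config sigma i (U V : {set 'I_N}) :
  (\sum_c config_prob sigma i c *
     ((\prod_(l in U) (config_value c l).1) * \prod_(l in V) (config_value c l).2))%:E =
  P [set w | (forall l, l \in U -> I1 a b sigma i (tnth (Z l w) i)) /\
             (forall l, l \in V -> I2 a b sigma i (tnth (Z l w) i))].
Proof.
pose Q (c : config) := [forall l in U, (c l).1 && (c l).2] && [forall l in V, (c l).2].
under eq_bigr => c _ do rewrite !prod_natr_forall -natrM mulnb -/(Q c).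
rewrite -(probability_pred_comp P Q (measurable_config_event sigma i)).
congr (P _); apply/seteqP; split => w /=.
  move=> /andP[/forall_inP hU /forall_inP hV]; split => l lW.
    by have := hU l lW; rewrite !ffunE /= tnth_mktuple => /andP[/set_mem].
  by have := hV l lW; rewrite !ffunE /= tnth_mktuple => /set_mem.
move=> [hU hV]; apply/andP; split; apply/forall_inP => l lW;
  rewrite !ffunE /= tnth_mktuple mem_set //; last exact: hV.
  by rewrite mem_set //; apply: sub_I1_I2 => //; exact: hU.
exact: hU.
Qed.

Hypothesis hunif : forall n, uniform_on_unit_cube (Z n).
Hypothesis hindep : mutually_independent (fun i : 'I_d => coord_vec Z i).
Hypothesis hdelta : forall i, 0 <= delta i.

Lemma probability_all_config sigma (k : {ffun 'I_d -> config}) :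
  P [set w | [ffun i => configuration sigma i (coord_vec Z i w)] = k] =
  (\prod_i config_prob sigma i (k i))%:E.
Proof.
have := hindep (u := [set: 'I_d]%SET)
  (S := fun i => [set t | configuration sigma i t = k i])
  (fun i _ => @measurable_configuration sigma i (k i)).
rewrite big_set /= -prodEFin => h.
transitivity (\prod_i P [set w | configuration sigma i (coord_vec Z i w) = k i])%E; last first.
  apply: eq_bigr => i _; rewrite fineK //; apply: fin_num_measure.
  exact: measurable_config_event.
rewrite -h; congr (P _); apply/seteqP; split => w /=.
  by move=> <- i _; rewrite ffunE.
by move=> hk; apply/ffunP => i; rewrite ffunE hk // finset.in_setT.
Qed.

(** The inequality for D and the one for its complement, at sigma = 0 and
    sigma = 1. Points outside u get the constant polynomial 1. *)
Lemma neg_dependence_bound sigma (u : {set 'I_N}) :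
  (forall i (U V : {set 'I_N}), U :&: V = finset.set0 ->
    (P [set w | (forall l, l \in U -> I1 a b sigma i (tnth (Z l w) i)) /\
                (forall l, l \in V -> I2 a b sigma i (tnth (Z l w) i))]
     <= (delta i)%:E * lebesgue_measure (I1 a b sigma i) ^+ #|U|
                     * lebesgue_measure (I2 a b sigma i) ^+ #|V|)%E) ->
  (P [set w | forall j, j \in u -> \1_D (Z j w) = (~~ sigma)%:R :> R] <=
   (\prod_i delta i)%:E *
     \prod_(j in u) P [set w | \1_D (Z j w) = (~~ sigma)%:R :> R])%E.
Proof.
move=> hcond.
pose G (l : 'I_N) (v : 'I_d -> R * R) := if l \in u then diff_value sigma v else 1.
have Gaff l : nonneg_affine (G l).
  rewrite /G; case: (l \in u); first exact: diff_value_affine.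
  move=> i v _; exists (coefs 1 0 0) => [k|p].
    by case: k => [[]|] /=; rewrite ?ler01.
  by rewrite big_option_bool /=; ring.
have adm (e : 'I_d -> config) l : admissible (fun i => config_value (e i) l).
  move=> i; rewrite /config_value /=.
  by case: (e i l) => [[] []] /=; rewrite ?lexx ?ler01.
have mom i (U V : {set 'I_N}) : U :&: V = finset.set0 ->
    \sum_c config_prob sigma i c *
      ((\prod_(l in U) (config_value c l).1) * \prod_(l in V) (config_value c l).2) <=
    delta i * ((interval_lengths a b sigma i).1 ^+ #|U| *
               (interval_lengths a b sigma i).2 ^+ #|V|).
  move=> UV; rewrite -lee_fin moment_config; apply: le_trans (hcond _ _ _ UV) _.
  by rewrite lebesgue_measure_I1 // lebesgue_measure_I2 // -!EFin_expe -!EFinM mulrA.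
have := mean_prod_le (@config_prob_ge0 sigma) (@config_prob_sum1 sigma) adm
  (interval_lengths_admissible ha hb sigma) mom Gaff hdelta.
pose Q (k : {ffun 'I_d -> config}) := [forall l in u, in_diff sigma
  (fun i => (k i l).1 && (k i l).2) (fun i => (k i l).2)].
have -> : (P [set w | forall j, j \in u -> \1_D (Z j w) = (~~ sigma)%:R :> R] =
    (hybrid_mean (config_prob sigma) (fun _ => config_value)
      (interval_lengths a b sigma) G [::])%:E)%E.
  have mk k : measurable
      [set w | [ffun i => configuration sigma i (coord_vec Z i w)] = k :> {ffun 'I_d -> config}].
    rewrite (_ : [set w | _] = [set w | forall i, configuration sigma i (coord_vec Z i w) = k i]).
      by apply: measurable_forall_fin => i; exact: measurable_config_event.
    apply/seteqP; split => w /=; first by move=> <- i; rewrite ffunE.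
    by move=> hk; apply/ffunP => i; rewrite ffunE hk.
  transitivity (P [set w | Q [ffun i => configuration sigma i (coord_vec Z i w)]]).
    have QE w l : in_diff sigma
        (fun i => ([ffun i => configuration sigma i (coord_vec Z i w)] i l).1 &&
                  ([ffun i => configuration sigma i (coord_vec Z i w)] i l).2)
        (fun i => ([ffun i => configuration sigma i (coord_vec Z i w)] i l).2) =
      in_diff sigma
        (fun i => tnth (Z l w) i \in I1 a b sigma i)
        (fun i => tnth (Z l w) i \in I2 a b sigma i).
      congr (in_diff sigma _ _); apply/funext => i; rewrite !ffunE /= tnth_mktuple //.
      apply/andP/idP => [[]//|xI]; split=> //; apply/mem_set.
      by apply: sub_I1_I2 => //; exact: set_mem.
    congr (P _); apply/seteqP; split => w /=.
      by move=> h; apply/forall_inP => l lu; rewrite QE; apply/indic_diffE; exact: h.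
    by move=> /forall_inP h l lu; apply/indic_diffE; rewrite -QE; exact: h.
  rewrite (probability_pred_comp P Q mk); congr EFin; apply: eq_bigr => k _.
  rewrite probability_all_config /=; congr (_ * _).
  have [/forall_inP h|/forall_inPn[l lu hl]] := boolP (Q k).
    rewrite big1 // => l _; rewrite /G; case: ifP => // lu.
    by rewrite diff_value_bool ?h // => i /andP[].
  rewrite (bigD1 l) //= /G lu diff_value_bool; last by move=> i /andP[].
  by rewrite (negbTE hl) mul0r.
rewrite -lee_fin EFinM => /le_trans; apply; rewrite le_eqVlt; apply/orP; left.
apply/eqP; congr (_ * _)%E; rewrite -prodEFin [RHS]big_mkcond.
apply: eq_bigr => l _; rewrite /G; case: ifP => // _.
by rewrite probability_indic_diff.
Qed.
End random_points.

(** * Negative dependence *)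

Theorem theorem3p7 (R : realType) (disp : measure_display)
    (T : measurableType disp) (P : probability T R) (d N : nat)
    (a b : d.-tuple R)
    (Z : 'I_N -> {RV P >-> d.-tuple R}) (delta : 'I_d -> R)
    (ha : unit_cube a) (hb : unit_cube b)
    (hZ : forall n w, unit_cube (Z n w))
    (* The Z_n are uniformly distributed. (ii) bounds probabilities by Lebesgue
       measures, the conclusion by marginal probabilities; without this link
       the conclusion is false, e.g. d = 1, N = 2, a = 0, b = 1/2, Z_1 = Z_2
       with probability 1/10 of lying in [0,1/2), delta = 4. *)
    (hunif : forall n, uniform_on_unit_cube (Z n))
    (hindep : mutually_independent (fun i : 'I_d => coord_vec Z i))
    (hdelta : forall i, 0 < delta i)
    (hcond : forall (i : 'I_d) (sigma : bool) (k nu : nat)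
                    (J Jnu Jknu : {set 'I_N}),
      (k <= N)%N -> (nu <= k)%N ->
      Jnu \subset J -> Jknu \subset J ->
      #|J| = k -> #|Jnu| = nu -> #|Jknu| = (k - nu)%N ->
      Jnu :&: Jknu = finset.set0 ->
      (P [set w | (forall l, l \in Jnu -> I1 a b sigma i (tnth (Z l w) i)) /\
                  (forall l, l \in Jknu -> I2 a b sigma i (tnth (Z l w) i))]
       <= (delta i)%:E * lebesgue_measure (I1 a b sigma i) ^+ nu
                       * lebesgue_measure (I2 a b sigma i) ^+ (k - nu))%E) :
  let A := box (origin R d) a in
  let B := box (origin R d) b in
  let D := B `\` A in
  neg_dependent P (\prod_(i < d) delta i)
    (fun n : 'I_N => fun w : T => \1_D (Z n w)).
Proof.
move=> A B D.
(* The sets of (ii) cover J, so J can only be their union. *)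
have moments i sigma (U V : {set 'I_N}) : U :&: V = finset.set0 ->
    (P [set w | (forall l, l \in U -> I1 a b sigma i (tnth (Z l w) i)) /\
                (forall l, l \in V -> I2 a b sigma i (tnth (Z l w) i))]
     <= (delta i)%:E * lebesgue_measure (I1 a b sigma i) ^+ #|U|
                     * lebesgue_measure (I2 a b sigma i) ^+ #|V|)%E.
  move=> UV; have cUV : #|U :|: V| = (#|U| + #|V|)%N.
    by rewrite cardsU UV cards0 subn0.
  have := hcond i sigma (#|U| + #|V|)%N #|U| (U :|: V) U V.
  rewrite addKn; apply => //.
  - by rewrite -cUV -[leqRHS]card_ord max_card.
  - exact: leq_addr.
  - exact: finset.subsetUl.
  - exact: finset.subsetUr.
(* For empty sets of indices, (ii) says 1 <= delta_i. *)
have delta_ge1 i : 1 <= delta i.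
  have := moments i false finset.set0 finset.set0 (finset.setI0 _).
  rewrite cards0 !expe0 !mule1 (_ : [set w | _] = setT) ?probability_setT ?lee_fin //.
  by apply/seteqP; split => // w _; split => l; rewrite finset.in_set0.
have delta_ge0 i : 0 <= delta i by exact: ltW.
split.
- by elim/big_ind: _ => // x y; exact: mulr_ege1.
- move=> j; apply: measurableT_comp; last exact: measurable_funPT.
  by apply: measurable_realfun.measurable_indic; exact: measurable_box_diff.
- by move=> j w; rewrite indicE; case: (_ \in D); [right|left].
- move=> u; have := neg_dependence_bound ha hb hZ hunif hindep delta_ge0 (sigma := false) u.
  by apply => i U V; exact: moments.
- move=> u; have := neg_dependence_bound ha hb hZ hunif hindep delta_ge0 (sigma := true) u.
  by apply => i U V; exact: moments.
Qed.
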